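(* Let $K$ be a field with $|K|=\aleph_0$ and $\operatorname{char}K\neq 2$, let $F_2$ be the free group with $2$ generators, let $\{V_j\mid j\in J\}$ be the set of all finitely generated right ideals of $KF_2$, and let $V=\prod_{j\in J}\left(KF_2/V_j\right)$, regarded as a right $KF_2$-module. Then there exists an ultrapower $(\widetilde V,\widetilde{F_2})$ of the representation $(V,F_2)$ which is not action type geometrically equivalent to $(V,F_2)$.
   Context: A representation $(V,G)$ over a commutative ring $K$ with unit is a group $G$ together with a right $KG$-module $V$ (action written $v\circ g$). A homomorphism of representations $(\alpha,\beta):(V,G)\to(W,H)$ is a $K$-module homomorphism $\alpha:V\to W$ together with a group homomorphism $\beta:G\to H$ such that $(v\circ g)^\alpha=v^\alpha\circ g^\beta$ for all $v\in V$, $g\in G$. For finite sets $X,Y$ let $F(Y)$ be the free group on $Y$, $XKF(Y)=\bigoplus_{x\in X}xKF(Y)$ the free right $KF(Y)$-module with basis $X$, and $W(X,Y)=(XKF(Y),F(Y))$. For $T\subset XKF(Y)$ put $T^{\nabla}_{(V,G)}=\{(\alpha,\beta)\in\mathrm{Hom}(W(X,Y),(V,G))\mid \ker\alpha\supset T\}$ and $T^{\nabla\nabla}_{(V,G)}=\bigcap_{(\alpha,\beta)\in T^{\nabla}_{(V,G)}}\ker\alpha$. Representations $(V_1,G_1)$ and $(V_2,G_2)$ over $K$ are action type geometrically equivalent if $T^{\nabla\nabla}_{(V_1,G_1)}=T^{\nabla\nabla}_{(V_2,G_2)}$ for all finite $X,Y$ and every $T\subset XKF(Y)$. An ultrapower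 of $(V,G)$ is a representation $(V^I/\!\sim,\ G^I/\!\sim)$, where $I$ is a set, $\mathfrak F$ is an ultrafilter over $I$, two elements of $V^I$ (respectively $G^I$) are $\sim$-equivalent when the set of indices where they agree belongs to $\mathfrak F$, and the action is $[v]\circ[g]=[v\circ g]$ with $v\circ g$ computed componentwise. *)

(* Defs.v *)
From HB Require Import structures.
From mathcomp Require Import all_boot all_algebra.
From mathcomp Require Import monoid finmap.
From mathcomp Require Import boolp classical_sets functions cardinality filter.
From mathcomp Require Import xfinmap monalg.

Set Implicit Arguments.
Unset Strict Implicit.
Unset Printing Implicit Defensive.

Import GRing.Theory.

Local Open Scope ring_scope.

(* The free group on [Y], realised as the reduced words in the letters        *)
(* [(y, false)] = y and [(y, true)] = y^-1.                                   *)
Section FreeGroup.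
Variable Y : choiceType.
Implicit Types (a b : Y * bool) (s t u : seq (Y * bool)).

Definition linv a : Y * bool := (a.1, ~~ a.2).

Definition reduced s : bool := sorted (fun a b => b != linv a) s.

Definition push a s : seq (Y * bool) :=
  if s is b :: s' then if b == linv a then s' else a :: s else [:: a].

Definition wmul s t := foldr push t s.

Record free_group := FreeGroup {fgval :> seq (Y * bool); _ : reduced fgval}.

HB.instance Definition _ := [isSub for fgval].
HB.instance Definition _ := [Choice of free_group by <:].

Lemma linvK : involutive linv.
Proof. by case=> y b; rewrite /linv /= negbK. Qed.

Lemma reduced_behead a s : reduced (a :: s) -> reduced s.
Proof. by case: s => //= b s /andP[]. Qed.

Lemma push_reduced a s : reduced s -> reduced (push a s).
Proof.
case: s => [//|b s] rs /=; case: eqP => [_|/eqP ne]; first exact: reduced_behead rs.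
by rewrite /reduced /= ne.
Qed.

Lemma pushK a s : reduced s -> push a (push (linv a) s) = s.
Proof.
case: s => [|b s] /= rs; first by rewrite eqxx.
rewrite linvK; case: eqP rs => [->|_ _] /=; last by rewrite eqxx.
by case: s => [//|c s] /= /andP[/negbTE ->].
Qed.

Lemma wmul_reduced s t : reduced t -> reduced (wmul s t).
Proof. by move=> rt; elim: s => //= a s; exact: push_reduced. Qed.

Lemma wmul_push a s t : reduced t -> wmul (push a s) t = push a (wmul s t).
Proof.
move=> rt; case: s => [//|b s] /=; case: eqP => [->|//].
by rewrite pushK ?wmul_reduced.
Qed.

Lemma wmulA s t u : reduced u -> wmul s (wmul t u) = wmul (wmul s t) u.
Proof. by move=> ru; elim: s => //= a s ->; rewrite wmul_push. Qed.

Lemma wmul1 s : reduced s -> wmul s [::] = s.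
Proof.
elim: s => //= a s IHs rs; rewrite IHs ?(reduced_behead rs) //.
by case: s rs {IHs} => //= b s /andP[/negbTE ->].
Qed.

Definition winv s := rev (map linv s).

Lemma winvK : involutive winv.
Proof. by move=> s; rewrite /winv map_rev revK mapK //; exact: linvK. Qed.

Lemma winv_reduced s : reduced s -> reduced (winv s).
Proof.
rewrite /reduced /winv rev_sorted sorted_map; case: s => //= a s.
apply: sub_path => b c /=; apply: contraNneq => /= e.
by rewrite -[c]linvK -e.
Qed.

Lemma wmulV s t : reduced t -> wmul s (wmul (winv s) t) = t.
Proof.
elim: s t => [//|a s IHs] t rt /=.
have -> : winv (a :: s) = winv s ++ [:: linv a].
  by rewrite /winv /= rev_cons -cats1.
by rewrite [wmul (_ ++ _) _]foldr_cat IHs ?push_reduced //= pushK.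
Qed.

Definition fg_one := @FreeGroup [::] isT.
Definition fg_mul (x y : free_group) :=
  FreeGroup (wmul_reduced x (valP y)).
Definition fg_inv (x : free_group) := FreeGroup (winv_reduced (valP x)).

Lemma fg_mulA : associative fg_mul.
Proof. by move=> x y z; apply: val_inj; rewrite /= wmulA ?(valP z). Qed.
Lemma fg_mul1g : left_id fg_one fg_mul.
Proof. by move=> x; apply: val_inj. Qed.
Lemma fg_mulg1 : right_id fg_one fg_mul.
Proof. by move=> x; apply: val_inj; rewrite /= wmul1 ?(valP x). Qed.
Lemma fg_mulgV : right_inverse fg_one fg_inv fg_mul.
Proof.
move=> x; apply: val_inj => /=.
by rewrite -[winv x]wmul1 ?wmulV // winv_reduced ?(valP x).
Qed.
Lemma fg_mulVg : left_inverse fg_one fg_inv fg_mul.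
Proof.
move=> x; have := fg_mulgV (fg_inv x); congr (fg_mul _ _ = _).
by apply: val_inj; rewrite /= winvK.
Qed.

HB.instance Definition _ := isGroup.Build free_group
  fg_mulA fg_mul1g fg_mulg1 fg_mulVg fg_mulgV.

(* The universal property. *)
Definition fg_gen (y : Y) : free_group := @FreeGroup [:: (y, false)] isT.

Section Lift.
Variables (G : groupType) (f : Y -> G).

Definition letter_val a : G := (if a.2 then (f a.1)^-1 else f a.1)%g.

Definition fg_lift (x : free_group) : G :=
  foldr (fun a g => letter_val a * g)%g 1%g (fgval x).

Lemma letter_valV a : letter_val (linv a) = ((letter_val a)^-1)%g.
Proof. by case: a => y [] //=; rewrite /letter_val /= invgK. Qed.

Lemma fg_lift_gen y : fg_lift (fg_gen y) = f y.
Proof. by rewrite /fg_lift /= mulg1. Qed.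

Lemma fg_liftM : {morph fg_lift : x y / (x * y)%g}.
Proof.
move=> [s rs] [t rt]; rewrite /fg_lift /=.
elim: s {rs} => [|a s IHs] /=; first by rewrite mul1g.
rewrite -mulgA -{}IHs; case: (wmul s t) => [//|b w] /=.
by case: eqP => [->|//] /=; rewrite letter_valV mulVKg.
Qed.

HB.instance Definition _ :=
  monoid.isMultiplicative.Build free_group G fg_lift fg_liftM.

Lemma fg_lift_unique (h : {multiplicative free_group -> G}) :
  (forall y, h (fg_gen y) = f y) -> h =1 fg_lift.
Proof.
move=> hf; have h1 : h 1%g = 1%g.
  by apply: (mulgI (h 1%g)); rewrite -gmulfM !mulg1.
case; elim=> [|[y b] s IHs] rs.
  by rewrite (_ : FreeGroup rs = 1%g) ?h1 //; apply: val_inj.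
have rs' := reduced_behead rs; rewrite /fg_lift /= -/(fg_lift (FreeGroup rs')).
have -> : FreeGroup rs =
    ((if b then (fg_gen y)^-1 else fg_gen y) * FreeGroup rs')%g.
  apply: val_inj; rewrite -[LHS]wmul1 // [LHS]/=.
  by rewrite [wmul s _]wmul1 //; case: (b).
rewrite gmulfM IHs /letter_val /=; case: b {rs} => /=; rewrite -hf //.
congr (_ * _)%g; apply: (mulgI (h (fg_gen y))).
by rewrite -gmulfM !mulgV h1.
Qed.

End Lift.

End FreeGroup.

(* The group algebra KG: finitely supported functions G -> K under            *)
(* convolution.  [monalg] only puts a product on [{malg K[G]}] for monoids    *)
(* without nontrivial units, hence the separate instance.                     *)
Definition group_algebra (K : comNzRingType) (G : groupType) : Type :=
  {malg K[G]}.

Section GroupAlgebra.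
Variables (K : comNzRingType) (G : groupType).
Local Notation KG := (group_algebra K G).
Implicit Types (a b c : {malg K[G]}) (g h : G).

HB.instance Definition _ := GRing.Lmodule.on KG.

Definition ga_one : {malg K[G]} := << 1%g >>.

Definition ga_mul a b : {malg K[G]} :=
  \sum_(g <- msupp a) \sum_(h <- msupp b) << a@_g * b@_h *g (g * h)%g >>.

Lemma ga_mulw (d1 d2 : {fset G}) a b :
  (msupp a `<=` d1)%fset -> (msupp b `<=` d2)%fset ->
  ga_mul a b = \sum_(g <- d1) \sum_(h <- d2) << a@_g * b@_h *g (g * h)%g >>.
Proof.
move=> le_d1 le_d2; rewrite /ga_mul (big_fset_incl _ le_d1) /=.
  apply/eq_bigr=> k1 _; apply/big_fset_incl => // k _ /mcoeff_outdom ->.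
  by rewrite mulr0 monalgU0.
move=> k _ /mcoeff_outdom g1k.
by rewrite big1 => // k' _; rewrite g1k mul0r monalgU0.
Qed.

Lemma ga_mul0g : left_zero 0 ga_mul.
Proof. by move=> a; rewrite /ga_mul msupp0 big_seq_fset0. Qed.

Lemma ga_mulg0 : right_zero 0 ga_mul.
Proof.
by move=> a; rewrite /ga_mul big1 // => g _; rewrite msupp0 big_seq_fset0.
Qed.

Lemma ga_mulUU (x y : K) g h :
  ga_mul << x *g g >> << y *g h >> = << x * y *g (g * h)%g >>.
Proof. by rewrite (ga_mulw msuppU_le msuppU_le) !big_seq_fset1 !mcoeffUU. Qed.

Lemma ga_mulDl : left_distributive ga_mul +%R.
Proof.
move=> a b c; have sc := fsubset_refl (msupp c).
rewrite (ga_mulw (msuppD_le a b) sc) (ga_mulw (fsubsetUl _ (msupp b)) sc).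
rewrite (ga_mulw (fsubsetUr (msupp a) _) sc) -big_split /=.
apply/eq_bigr=> k1 _; rewrite -big_split /=; apply/eq_bigr=> k2 _.
by rewrite mcoeffD mulrDl monalgUD.
Qed.

Lemma ga_mulDr : right_distributive ga_mul +%R.
Proof.
move=> c a b; have sc := fsubset_refl (msupp c).
rewrite (ga_mulw sc (msuppD_le a b)) (ga_mulw sc (fsubsetUl _ (msupp b))).
rewrite (ga_mulw sc (fsubsetUr (msupp a) _)) -big_split /=.
apply/eq_bigr=> k1 _; rewrite -big_split /=; apply/eq_bigr=> k2 _.
by rewrite mcoeffD mulrDr monalgUD.
Qed.

Lemma ga_mul_suml (I : Type) (r : seq I) (F : I -> {malg K[G]}) b :
  ga_mul (\sum_(i <- r) F i) b = \sum_(i <- r) ga_mul (F i) b.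
Proof.
exact: (big_morph (ga_mul^~ b) (fun x y => ga_mulDl x y b) (ga_mul0g b)).
Qed.

Lemma ga_mul_sumr (I : Type) (r : seq I) (F : I -> {malg K[G]}) b :
  ga_mul b (\sum_(i <- r) F i) = \sum_(i <- r) ga_mul b (F i).
Proof. exact: (big_morph (ga_mul b) (ga_mulDr b) (ga_mulg0 b)). Qed.

Lemma ga_mul1g : left_id ga_one ga_mul.
Proof.
move=> a; rewrite {1}[a]monalgE ga_mul_sumr [RHS]monalgE.
by apply/eq_bigr=> g _; rewrite ga_mulUU mul1r mul1g.
Qed.

Lemma ga_mulg1 : right_id ga_one ga_mul.
Proof.
move=> a; rewrite {1}[a]monalgE ga_mul_suml [RHS]monalgE.
by apply/eq_bigr=> g _; rewrite ga_mulUU mulr1 mulg1.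
Qed.

Lemma ga_mulA : associative ga_mul.
Proof.
move=> a b c; rewrite [a]monalgE !ga_mul_suml; apply/eq_bigr=> g _.
rewrite [b]monalgE !(ga_mul_suml, ga_mul_sumr); apply/eq_bigr=> h _.
rewrite [c]monalgE !ga_mul_sumr; apply/eq_bigr=> k _.
by rewrite !ga_mulUU mulrA mulgA.
Qed.

Lemma ga_oner_neq0 : ga_one != 0.
Proof.
by apply/eqP/malgP=> /(_ 1%g) /eqP; rewrite mcoeffUU mcoeff0 oner_eq0.
Qed.

HB.instance Definition _ := GRing.Zmodule_isNzRing.Build KG
  ga_mulA ga_mul1g ga_mulg1 ga_mulDl ga_mulDr ga_oner_neq0.

Lemma ga_scaleU (x y : K) g : x *: << y *g g >> = << x * y *g g >> :> {malg K[G]}.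
Proof. by apply/malgP => h; rewrite mcoeffZ !mcoeffU mulrnAr. Qed.

Lemma ga_scaleAl (x : K) (a b : KG) : x *: (a * b) = (x *: a) * b.
Proof.
rewrite /GRing.mul /= [a]monalgE ga_mul_suml !scaler_sumr ga_mul_suml.
apply/eq_bigr=> g _; rewrite [b]monalgE !ga_mul_sumr !scaler_sumr.
by apply/eq_bigr=> h _; rewrite ga_scaleU !ga_mulUU ga_scaleU mulrA.
Qed.

HB.instance Definition _ := GRing.Lmodule_isLalgebra.Build K KG ga_scaleAl.

Lemma ga_scaleAr (x : K) (a b : KG) : x *: (a * b) = a * (x *: b).
Proof.
rewrite /GRing.mul /= [a]monalgE !ga_mul_suml !scaler_sumr.
apply/eq_bigr=> g _; rewrite [b]monalgE ga_mul_sumr !scaler_sumr.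
rewrite ga_mul_sumr; apply/eq_bigr=> h _.
by rewrite ga_scaleU !ga_mulUU ga_scaleU mulrCA.
Qed.

HB.instance Definition _ := GRing.Lalgebra_isAlgebra.Build K KG ga_scaleAr.

Definition gelt (g : G) : KG := << g >>.

Lemma gelt1 : gelt 1%g = 1. Proof. by []. Qed.

Lemma geltM g h : gelt (g * h)%g = gelt g * gelt h.
Proof. by rewrite /GRing.mul /= ga_mulUU mulr1. Qed.

Lemma gelt_sum (a : KG) : a = \sum_(g <- msupp a) a@_g *: gelt g.
Proof.
rewrite [LHS]monalgE; apply/eq_bigr => g _.
by rewrite /gelt /= ga_scaleU mulr1.
Qed.

End GroupAlgebra.

(* A right KG-module; its K-module structure is the one induced by            *)
(* K -> KG, as required by [rm_actZ].                                         *)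
Record right_module (K : comNzRingType) (G : groupType) := RightModule {
  rm_mod :> lmodType K;
  rm_act : rm_mod -> group_algebra K G -> rm_mod;
  rm_actDl : forall a, {morph rm_act^~ a : u v / u + v};
  rm_actDr : forall v, {morph rm_act v : a b / a + b};
  rm_act1 : forall v, rm_act v 1 = v;
  rm_actM : forall v a b, rm_act v (a * b) = rm_act (rm_act v a) b;
  rm_actZ : forall v (k : K), rm_act v k%:A = k *: v
}.

Record representation (K : comNzRingType) := Representation {
  rep_grp : groupType;
  rep_mod : right_module K rep_grp
}.

Definition rep_act (K : comNzRingType) (R : representation K)
    (v : rep_mod R) (g : rep_grp R) : rep_mod R := rm_act v (gelt K g).

Record rep_hom (K : comNzRingType) (R S : representation K) := RepHom {
  hom_mod : {linear rep_mod R -> rep_mod S};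
  hom_grp : {multiplicative rep_grp R -> rep_grp S};
  hom_act : forall v g,
    hom_mod (rep_act v g) = rep_act (hom_mod v) (hom_grp g)
}.

(* A K-linear right action of G extends uniquely to a right KG-module; the    *)
(* ultrapower needs this, its action being given on group elements only.      *)
Section ModuleOfAction.
Variables (K : comNzRingType) (G : groupType) (V : lmodType K).
Variable act : V -> G -> V.
Hypothesis act_lin : forall g (k : K) u v,
  act (k *: u + v) g = k *: act u g + act v g.
Hypothesis act1 : forall v, act v 1%g = v.
Hypothesis actM : forall v g h, act v (g * h)%g = act (act v g) h.

Definition ext_act (v : V) (a : group_algebra K G) : V :=
  \sum_(g <- msupp a) a@_g *: act v g.

Lemma ext_act_w (d : {fset G}) v (a : group_algebra K G) :
  (msupp a `<=` d)%fset -> ext_act v a = \sum_(g <- d) a@_g *: act v g.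
Proof.
move=> le; rewrite /ext_act (big_fset_incl _ le) // => g _ /mcoeff_outdom ->.
by rewrite scale0r.
Qed.

Lemma actD g u v : act (u + v) g = act u g + act v g.
Proof. by have := act_lin g 1 u v; rewrite !scale1r. Qed.

Lemma act0 g : act 0 g = 0.
Proof. by apply: (addIr (act 0 g)); rewrite -actD !add0r. Qed.

Lemma actZ g (k : K) u : act (k *: u) g = k *: act u g.
Proof. by have := act_lin g k u 0; rewrite act0 !addr0. Qed.

Lemma ext_actDl a : {morph ext_act^~ a : u v / u + v}.
Proof.
move=> u v; rewrite /ext_act -big_split; apply: eq_bigr => g _.
by rewrite actD scalerDr.
Qed.

Lemma ext_actDr v : {morph ext_act v : a b / a + b}.
Proof.
move=> a b; rewrite (ext_act_w _ (msuppD_le a b)).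
rewrite (ext_act_w _ (fsubsetUl _ (msupp b))).
rewrite (ext_act_w _ (fsubsetUr (msupp a) _)) -big_split /=.
by apply/eq_bigr=> g _; rewrite mcoeffD scalerDl.
Qed.

Lemma ext_act0r v : ext_act v 0 = 0.
Proof. by rewrite /ext_act msupp0 big_seq_fset0. Qed.

Lemma ext_act0l a : ext_act 0 a = 0.
Proof. by rewrite /ext_act big1 // => g _; rewrite act0 scaler0. Qed.

Lemma ext_actU v (k : K) g : ext_act v << k *g g >> = k *: act v g.
Proof. by rewrite (ext_act_w _ msuppU_le) big_seq_fset1 mcoeffUU. Qed.

Lemma ext_act1 v : ext_act v 1 = v.
Proof. by rewrite ext_actU scale1r act1. Qed.

Lemma ext_act_gelt v g : ext_act v (gelt K g) = act v g.
Proof. by rewrite ext_actU scale1r. Qed.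

Lemma ext_act_sumr (I : Type) (r : seq I) (F : I -> group_algebra K G) v :
  ext_act v (\sum_(i <- r) F i) = \sum_(i <- r) ext_act v (F i).
Proof. exact: (big_morph (ext_act v) (ext_actDr v) (ext_act0r v)). Qed.

Lemma ext_act_suml (I : Type) (r : seq I) (F : I -> V) a :
  ext_act (\sum_(i <- r) F i) a = \sum_(i <- r) ext_act (F i) a.
Proof. exact: (big_morph (ext_act^~ a) (ext_actDl a) (ext_act0l a)). Qed.

Lemma ext_actM v a b : ext_act v (a * b) = ext_act (ext_act v a) b.
Proof.
rewrite {1}/GRing.mul /= /ga_mul ext_act_sumr [ext_act v a]/ext_act.
rewrite ext_act_suml.
apply/eq_bigr => g _; rewrite ext_act_sumr; apply/eq_bigr => h _.
by rewrite ext_actU actZ actM !scalerA mulrC.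
Qed.

Lemma ext_actZ v (k : K) : ext_act v k%:A = k *: v.
Proof.
by rewrite -gelt1 [k *: _]ga_scaleU mulr1 ext_actU act1.
Qed.

Definition module_of_action : right_module K G :=
  RightModule ext_actDl ext_actDr ext_act1 ext_actM ext_actZ.

End ModuleOfAction.

(* An element of XKG is given by its coordinates in the basis X. *)
Section FreeModule.
Variables (K : comNzRingType) (G : groupType) (X : finType).
Local Notation M := {ffun X -> group_algebra K G}.

Definition fm_act (v : M) (a : group_algebra K G) : M := [ffun x => v x * a].

Lemma fm_actDl a : {morph fm_act^~ a : u v / u + v}.
Proof. by move=> u v; apply/ffunP => x; rewrite !ffunE mulrDl. Qed.
Lemma fm_actDr v : {morph fm_act v : a b / a + b}.
Proof. by move=> a b; apply/ffunP => x; rewrite !ffunE mulrDr. Qed.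
Lemma fm_act1 v : fm_act v 1 = v.
Proof. by apply/ffunP => x; rewrite !ffunE mulr1. Qed.
Lemma fm_actM v a b : fm_act v (a * b) = fm_act (fm_act v a) b.
Proof. by apply/ffunP => x; rewrite !ffunE mulrA. Qed.
Lemma fm_actZ v (k : K) : fm_act v k%:A = k *: v.
Proof. by apply/ffunP => x; rewrite !ffunE mulr_algr. Qed.

Definition free_right_module : right_module K G :=
  RightModule fm_actDl fm_actDr fm_act1 fm_actM fm_actZ.

End FreeModule.

Definition Wrep (K : comNzRingType) (X Y : finType) : representation K :=
  @Representation K (free_group Y) (free_right_module K (free_group Y) X).

Section Equivalence.
Variable K : comNzRingType.
Local Open Scope classical_set_scope.

Definition hom_ker (R S : representation K) (h : rep_hom R S) :
    set (rep_mod R) := [set w | hom_mod h w = 0].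

Definition nabla (X Y : finType) (R : representation K)
    (T : set (rep_mod (Wrep K X Y))) : set (rep_hom (Wrep K X Y) R) :=
  [set h | T `<=` hom_ker h].
Arguments nabla {X Y} R T.

Definition nabla2 (X Y : finType) (R : representation K)
    (T : set (rep_mod (Wrep K X Y))) : set (rep_mod (Wrep K X Y)) :=
  \bigcap_(h in nabla R T) hom_ker h.

Definition action_type_equivalent (R1 R2 : representation K) : Prop :=
  forall (X Y : finType) (T : set (rep_mod (Wrep K X Y))),
    nabla2 R1 T = nabla2 R2 T.

End Equivalence.

Section RightIdeals.
Variable R : nzRingType.
Local Open Scope classical_set_scope.

Definition right_ideal (A : set R) : Prop :=
  [/\ A 0, forall u v, A u -> A v -> A (u + v) & forall u a, A u -> A (u * a)].

Definition fg_right_ideal (A : set R) : Prop :=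
  right_ideal A /\ exists s : seq R, A = smallest right_ideal [set` s].

Definition ideal_mem (A : set R) of right_ideal A : R -> bool :=
  fun u => `[< A u >].

Lemma ideal_mem_closed (A : set R) (hA : right_ideal A) :
  zmod_closed (ideal_mem hA).
Proof.
case: (hA) => A0 AD AM; split; first exact/asboolP.
move=> u v /asboolP Au /asboolP Av; apply/asboolP; apply: AD => //.
by rewrite -mulrN1; apply: AM.
Qed.

HB.instance Definition _ (A : set R) (hA : right_ideal A) :=
  GRing.isZmodClosed.Build R (ideal_mem hA) (ideal_mem_closed hA).

End RightIdeals.

Section QuotientModule.
Variables (K : comNzRingType) (G : groupType).
Local Notation KG := (group_algebra K G).
Variables (A : set KG) (hA : right_ideal A).
Local Open Scope quotient_scope.

Definition ideal_zmod : zmodClosed KG :=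
  GRing.ZmodClosed.clone KG (ideal_mem hA) _.

Definition rideal_quot : Type := {ideal_quot ideal_zmod}.

HB.instance Definition _ := GRing.Zmodule.on rideal_quot.
HB.instance Definition _ := Quotient.on rideal_quot.

Definition iq_scale (k : K) (x : rideal_quot) : rideal_quot :=
  \pi_rideal_quot (k *: repr x).
Definition iq_act (x : rideal_quot) (a : KG) : rideal_quot :=
  \pi_rideal_quot (repr x * a).

Lemma iq_actE u a : iq_act (\pi_rideal_quot u) a = \pi_rideal_quot (u * a).
Proof.
apply/eqP; rewrite /iq_act -[_ == _]Quotient.idealrBE -mulrBl.
apply/asboolP; case: (hA) => _ _; apply.
by apply/asboolP; rewrite -[asbool _]/(_ \in ideal_mem hA) Quotient.idealrBE reprK.
Qed.

Lemma iq_scaleE k u : iq_scale k (\pi_rideal_quot u) = \pi_rideal_quot (k *: u).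
Proof. by rewrite -[k *: u]mulr_algr -iq_actE /iq_act mulr_algr. Qed.

Lemma iq_piD (u v : KG) : \pi_rideal_quot (u + v) = \pi_rideal_quot u + \pi_rideal_quot v.
Proof. by rewrite [RHS]piE. Qed.

Lemma iq_scaleA (k l : K) (x : rideal_quot) :
  iq_scale k (iq_scale l x) = iq_scale (k * l) x.
Proof.
by rewrite -[x]reprK (iq_scaleE l) !iq_scaleE scalerA.
Qed.

Lemma iq_scale1 (x : rideal_quot) : iq_scale 1 x = x.
Proof. by rewrite -[x]reprK iq_scaleE scale1r. Qed.

Lemma iq_scaleDr (k : K) : {morph iq_scale k : x y / x + y}.
Proof.
move=> x y; rewrite -[x]reprK -[y]reprK -iq_piD !iq_scaleE -iq_piD.
by rewrite scalerDr.
Qed.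

Lemma iq_scaleDl (x : rideal_quot) :
  {morph iq_scale^~ x : k l / k + l}.
Proof. by move=> k l; rewrite -[x]reprK !iq_scaleE -iq_piD scalerDl. Qed.

HB.instance Definition _ := GRing.Zmodule_isLmodule.Build K rideal_quot
  iq_scaleA iq_scale1 iq_scaleDr iq_scaleDl.

Lemma iq_actDl a : {morph iq_act^~ a : x y / x + y}.
Proof.
move=> x y; rewrite -[x]reprK -[y]reprK -iq_piD !iq_actE -iq_piD.
by rewrite mulrDl.
Qed.

Lemma iq_actDr (x : rideal_quot) : {morph iq_act x : a b / a + b}.
Proof. by move=> a b; rewrite -[x]reprK !iq_actE -iq_piD mulrDr. Qed.

Lemma iq_act1 (x : rideal_quot) : iq_act x 1 = x.
Proof. by rewrite -[x]reprK iq_actE mulr1. Qed.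

Lemma iq_actM (x : rideal_quot) a b : iq_act x (a * b) = iq_act (iq_act x a) b.
Proof. by rewrite -[x]reprK (iq_actE _ a) !iq_actE mulrA. Qed.

Lemma iq_actZ (x : rideal_quot) (k : K) : iq_act x k%:A = k *: x.
Proof. by rewrite -[x]reprK iq_actE mulr_algr -iq_scaleE. Qed.

Definition quotient_module : right_module K G :=
  RightModule iq_actDl iq_actDr iq_act1 iq_actM iq_actZ.

End QuotientModule.

Definition dprod (J : Type) (V : J -> Type) : Type := forall j, V j.

Section ProductModule.
Variables (K : comNzRingType) (G : groupType) (J : Type).
Variable V : J -> right_module K G.
Local Notation P := (dprod V).
Implicit Types u v w : P.

HB.instance Definition _ := Choice.copy P (forall j, V j).

Definition dp_add u v : P := fun j => u j + v j.
Definition dp_opp u : P := fun j => - u j.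
Definition dp_zero : P := fun j => 0.
Definition dp_scale (k : K) u : P := fun j => k *: u j.
Definition dp_act u (a : group_algebra K G) : P := fun j => rm_act (u j) a.

Lemma dp_addA : associative dp_add.
Proof. by move=> u v w; apply: functional_extensionality_dep => j; exact: addrA. Qed.
Lemma dp_addC : commutative dp_add.
Proof. by move=> u v; apply: functional_extensionality_dep => j; exact: addrC. Qed.
Lemma dp_add0 : left_id dp_zero dp_add.
Proof. by move=> u; apply: functional_extensionality_dep => j; exact: add0r. Qed.
Lemma dp_addN : left_inverse dp_zero dp_opp dp_add.
Proof. by move=> u; apply: functional_extensionality_dep => j; exact: addNr. Qed.

HB.instance Definition _ := GRing.isZmodule.Build P
  dp_addA dp_addC dp_add0 dp_addN.

Lemma dp_scaleA k l u : dp_scale k (dp_scale l u) = dp_scale (k * l) u.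
Proof. by apply: functional_extensionality_dep => j; exact: scalerA. Qed.
Lemma dp_scale1 u : dp_scale 1 u = u.
Proof. by apply: functional_extensionality_dep => j; exact: scale1r. Qed.
Lemma dp_scaleDr k : {morph dp_scale k : u v / u + v}.
Proof. by move=> u v; apply: functional_extensionality_dep => j; exact: scalerDr. Qed.
Lemma dp_scaleDl u : {morph dp_scale^~ u : k l / k + l}.
Proof. by move=> k l; apply: functional_extensionality_dep => j; exact: scalerDl. Qed.

HB.instance Definition _ := GRing.Zmodule_isLmodule.Build K P
  dp_scaleA dp_scale1 dp_scaleDr dp_scaleDl.

Lemma dp_actDl a : {morph dp_act^~ a : u v / u + v}.
Proof. by move=> u v; apply: functional_extensionality_dep => j; exact: rm_actDl. Qed.
Lemma dp_actDr u : {morph dp_act u : a b / a + b}.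
Proof. by move=> a b; apply: functional_extensionality_dep => j; exact: rm_actDr. Qed.
Lemma dp_act1 u : dp_act u 1 = u.
Proof. by apply: functional_extensionality_dep => j; exact: rm_act1. Qed.
Lemma dp_actM u a b : dp_act u (a * b) = dp_act (dp_act u a) b.
Proof. by apply: functional_extensionality_dep => j; exact: rm_actM. Qed.
Lemma dp_actZ u (k : K) : dp_act u k%:A = k *: u.
Proof. by apply: functional_extensionality_dep => j; exact: rm_actZ. Qed.

Definition product_module : right_module K G :=
  RightModule dp_actDl dp_actDr dp_act1 dp_actM dp_actZ.

End ProductModule.

Section UltraQuotient.
Variables (I : Type) (F : set_system I) (FU : UltraFilter F).
Variable T : choiceType.
Local Open Scope classical_set_scope.
Local Open Scope quotient_scope.

Definition ultra_equiv of UltraFilter F : rel (I -> T) :=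
  fun u v => `[< F [set i | u i = v i] >].

Lemma ultra_equiv_class : equiv_class_of (ultra_equiv FU).
Proof.
split=> [u|u v|v u w].
- by apply/asboolP; apply: filterS filterT => i _.
- by apply/asbool_equiv_eq; split; apply: filterS => i /=.
- move=> /asboolP uv /asboolP vw; apply/asboolP.
  by apply: filterS (filterI uv vw) => i [/= -> ->].
Qed.

Canonical ultra_equivRel := EquivRelPack ultra_equiv_class.
Canonical ultra_encModRel := defaultEncModRel (ultra_equiv FU).

Definition ultra : Type := {eq_quot ultra_equiv FU}.

HB.instance Definition _ : EqQuotient (I -> T) (ultra_equiv FU) ultra :=
  EqQuotient.on ultra.
HB.instance Definition _ := Choice.on ultra.

Definition ucls (u : I -> T) : ultra := \pi_ultra u.

Lemma uclsP u v : ucls u = ucls v <-> F [set i | u i = v i].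
Proof.
by split=> [/eqP|h]; [|apply/eqP]; rewrite /ucls piE; [move/asboolP|apply/asboolP].
Qed.

Lemma ucls_repr (x : ultra) : ucls (repr x) = x.
Proof. exact: reprK. Qed.

Lemma ucls_ind (P : ultra -> Prop) : (forall u, P (ucls u)) -> forall x, P x.
Proof. by move=> h x; rewrite -[x]ucls_repr. Qed.

End UltraQuotient.
Arguments ultra {I F} FU T.
Arguments ucls {I F} FU {T} u.

Section UltraOps.
Variables (I : Type) (F : set_system I) (FU : UltraFilter F).

Definition ultra_map (S T : choiceType) (f : S -> T) (x : ultra FU S) :
    ultra FU T := ucls FU (fun i => f (repr x i)).

Definition ultra_map2 (S S' T : choiceType) (f : S -> S' -> T)
    (x : ultra FU S) (y : ultra FU S') : ultra FU T :=
  ucls FU (fun i => f (repr x i) (repr y i)).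

Lemma repr_ucls (T : choiceType) (u : I -> T) :
  F [set i | repr (ucls FU u) i = u i]%classic.
Proof. by apply/(uclsP FU); rewrite ucls_repr. Qed.

Lemma ultra_mapE (S T : choiceType) (f : S -> T) u :
  ultra_map f (ucls FU u) = ucls FU (fun i => f (u i)).
Proof. by apply/uclsP; apply: filterS (repr_ucls u) => i /= ->. Qed.

Lemma ultra_map2E (S S' T : choiceType) (f : S -> S' -> T) u v :
  ultra_map2 f (ucls FU u) (ucls FU v) = ucls FU (fun i => f (u i) (v i)).
Proof.
apply/uclsP; apply: filterS (filterI (repr_ucls u) (repr_ucls v)).
by move=> i [/= -> ->].
Qed.

End UltraOps.

Section UltraGroup.
Variables (I : Type) (F : set_system I) (FU : UltraFilter F) (G : groupType).
Local Notation U := (ultra FU G).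

Definition ug_one : U := ucls FU (fun=> 1%g).
Definition ug_inv : U -> U := ultra_map (fun g : G => g^-1%g).
Definition ug_mul : U -> U -> U := ultra_map2 (fun g h : G => (g * h)%g).

Lemma ug_mulA : associative ug_mul.
Proof.
elim/ucls_ind=> u; elim/ucls_ind=> v; elim/ucls_ind=> w.
rewrite /ug_mul (ultra_map2E _ _ v w) (ultra_map2E _ _ u v) !ultra_map2E.
by congr ucls; apply/funext=> i; exact: mulgA.
Qed.
Lemma ug_mul1g : left_id ug_one ug_mul.
Proof.
elim/ucls_ind=> u; rewrite /ug_mul ultra_map2E.
by congr ucls; apply/funext=> i; exact: mul1g.
Qed.
Lemma ug_mulg1 : right_id ug_one ug_mul.
Proof.
elim/ucls_ind=> u; rewrite /ug_mul ultra_map2E.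
by congr ucls; apply/funext=> i; exact: mulg1.
Qed.
Lemma ug_mulVg : left_inverse ug_one ug_inv ug_mul.
Proof.
elim/ucls_ind=> u; rewrite /ug_mul /ug_inv ultra_mapE ultra_map2E.
by congr ucls; apply/funext=> i; exact: mulVg.
Qed.
Lemma ug_mulgV : right_inverse ug_one ug_inv ug_mul.
Proof.
elim/ucls_ind=> u; rewrite /ug_mul /ug_inv ultra_mapE ultra_map2E.
by congr ucls; apply/funext=> i; exact: mulgV.
Qed.

HB.instance Definition _ := isGroup.Build U
  ug_mulA ug_mul1g ug_mulg1 ug_mulVg ug_mulgV.

End UltraGroup.

Section UltraModule.
Variables (I : Type) (F : set_system I) (FU : UltraFilter F).
Variables (K : comNzRingType) (V : lmodType K).
Local Notation U := (ultra FU V).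

Definition um_zero : U := ucls FU (fun=> 0).
Definition um_opp : U -> U := ultra_map (fun v : V => - v).
Definition um_add : U -> U -> U := ultra_map2 (fun u v : V => u + v).
Definition um_scale (k : K) : U -> U := ultra_map (fun v : V => k *: v).

Lemma um_addA : associative um_add.
Proof.
elim/ucls_ind=> u; elim/ucls_ind=> v; elim/ucls_ind=> w.
rewrite /um_add (ultra_map2E _ _ v w) (ultra_map2E _ _ u v) !ultra_map2E.
by congr ucls; apply/funext=> i; exact: addrA.
Qed.
Lemma um_addC : commutative um_add.
Proof.
elim/ucls_ind=> u; elim/ucls_ind=> v.
by rewrite /um_add !ultra_map2E; congr ucls; apply/funext=> i; exact: addrC.
Qed.
Lemma um_add0 : left_id um_zero um_add.
Proof.
elim/ucls_ind=> u; rewrite /um_add ultra_map2E.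
by congr ucls; apply/funext=> i; exact: add0r.
Qed.
Lemma um_addN : left_inverse um_zero um_opp um_add.
Proof.
elim/ucls_ind=> u; rewrite /um_add /um_opp ultra_mapE ultra_map2E.
by congr ucls; apply/funext=> i; exact: addNr.
Qed.

HB.instance Definition _ := GRing.isZmodule.Build U
  um_addA um_addC um_add0 um_addN.

Lemma um_scaleA k l x : um_scale k (um_scale l x) = um_scale (k * l) x.
Proof.
elim/ucls_ind: x => u; rewrite /um_scale !ultra_mapE.
by congr ucls; apply/funext=> i; exact: scalerA.
Qed.
Lemma um_scale1 x : um_scale 1 x = x.
Proof.
elim/ucls_ind: x => u; rewrite /um_scale ultra_mapE.
by congr ucls; apply/funext=> i; exact: scale1r.
Qed.
Lemma um_scaleDr k : {morph um_scale k : x y / x + y}.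
Proof.
elim/ucls_ind=> u; elim/ucls_ind=> v.
rewrite /um_scale /GRing.add /= /um_add !(ultra_mapE, ultra_map2E).
by congr ucls; apply/funext=> i; exact: scalerDr.
Qed.
Lemma um_scaleDl x : {morph um_scale^~ x : k l / k + l}.
Proof.
move=> k l; elim/ucls_ind: x => u.
rewrite /um_scale !ultra_mapE [in RHS]/GRing.add /= /um_add ultra_map2E.
by congr ucls; apply/funext=> i; exact: scalerDl.
Qed.

HB.instance Definition _ := GRing.Zmodule_isLmodule.Build K U
  um_scaleA um_scale1 um_scaleDr um_scaleDl.

Lemma um_addE u v : ucls FU u + ucls FU v = ucls FU (fun i => u i + v i) :> U.
Proof. exact: ultra_map2E. Qed.

Lemma um_scaleE k u : k *: (ucls FU u : U) = ucls FU (fun i => k *: u i).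
Proof. exact: ultra_mapE. Qed.

End UltraModule.

Section Ultrapower.
Variables (I : Type) (F : set_system I) (FU : UltraFilter F).
Variables (K : comNzRingType) (R : representation K).
Local Notation V := (rm_mod (rep_mod R)).
Local Notation G := (rep_grp R).

Definition up_act : ultra FU V -> ultra FU G -> ultra FU V :=
  ultra_map2 (@rep_act K R).

Lemma up_actE u g :
  up_act (ucls FU u) (ucls FU g) = ucls FU (fun i => rep_act (u i) (g i)).
Proof. exact: ultra_map2E. Qed.

Lemma rm_act_lin (M : right_module K G) a (k : K) (u v : M) :
  rm_act (k *: u + v) a = k *: rm_act u a + rm_act v a.
Proof.
by rewrite rm_actDl -rm_actZ -rm_actM mulr_algl -mulr_algr rm_actM rm_actZ.
Qed.

Lemma up_act_lin g (k : K) x y :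
  up_act (k *: x + y) g = k *: up_act x g + up_act y g.
Proof.
elim/ucls_ind: g => g; elim/ucls_ind: x => u; elim/ucls_ind: y => v.
rewrite um_scaleE um_addE !up_actE um_scaleE um_addE.
by congr ucls; apply/funext=> i; exact: rm_act_lin.
Qed.

Lemma up_act1 x : up_act x 1%g = x.
Proof.
elim/ucls_ind: x => u; rewrite [1%g]/(ug_one _ _) up_actE.
by congr ucls; apply/funext=> i; rewrite /rep_act gelt1 rm_act1.
Qed.

Lemma up_actM x g h : up_act x (g * h)%g = up_act (up_act x g) h.
Proof.
elim/ucls_ind: g => g; elim/ucls_ind: h => h; elim/ucls_ind: x => u.
rewrite [(ucls FU g * _)%g]ultra_map2E !up_actE.
by congr ucls; apply/funext=> i; rewrite /rep_act geltM rm_actM.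
Qed.

Definition ultrapower : representation K :=
  Representation (module_of_action up_act_lin up_act1 up_actM).

Lemma ultrapower_actE (x : ultra FU V) (g : ultra FU G) :
  @rep_act K ultrapower x g = up_act x g.
Proof. exact: ext_act_gelt. Qed.

End Ultrapower.

Definition F2 : groupType := free_group 'I_2.

Definition product_fg_quotients (K : comNzRingType) : right_module K F2 :=
  product_module (fun A : {A : set (group_algebra K F2) | fg_right_ideal A} =>
    quotient_module (proj1 (proj2_sig A))).

(* Main.v *)
From HB Require Import structures.
Require Import Defs.
From mathcomp Require Import all_boot all_algebra.
From mathcomp Require Import boolp classical_sets functions cardinality filter.
From mathcomp Require Import fingroup perm finmap generic_quotient monalg.

(* Put w_i = a^-i b a^i in F_2.  Since 2 is invertible, a nonzero vector v of *)
(* a quotient KF_2/A cannot satisfy both v w = v and v w = -v.  There are     *)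
(* only countably many pairs of an endomorphism beta of F_2 and a vector of   *)
(* some KF_2/A with A finitely generated, so a diagonal choice of signs eps_i *)
(* ensures that no nonzero v in V satisfies v beta(w_i) = eps_i v for all i,  *)
(* whatever beta is.  Any finitely many of these equations do have a nonzero  *)
(* solution with beta = id, because signed permutations realise the signs on  *)
(* a cyclically permuted basis; so a nonprincipal ultrapower over nat has a   *)
(* nonzero solution of all of them.                                           *)

Set Implicit Arguments.
Unset Strict Implicit.
Unset Printing Implicit Defensive.

Import GRing.Theory.
Local Open Scope ring_scope.
Local Open Scope classical_set_scope.

(** The representations are separated by $T=\{x(w_i-\varepsilon_i)\mid i\ge 0\}$ in the free module
    on one generator $x$. A homomorphism $(\alpha,\beta)$ kills $T$ exactly when $x^\alpha\circ
    w_i^\beta=\varepsilon_i x^\alpha$ for all $i$. Over $V$, [diagonal_signs] makes every coordinate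
    of such an $x^\alpha$ vanish, so $x\in T^{\nabla\nabla}$. In the ultrapower, take the class of
    $(v_n)$, where $v_n$ is the coset of 1 in each $KF_2/V_j$ whose $V_j$ contains the first $n$
    elements $w_i-\varepsilon_i$, and 0 elsewhere. Each equation holds for all large $n$, and
    $v_n\ne 0$ because these elements generate a proper right ideal ([sign_ideal_proper], resting on
    [sign_vec_conj_gen]). *)

Lemma smallest_right_ideal (R : nzRingType) (S : set R) :
  right_ideal (smallest (@right_ideal R) S).
Proof.
split=> [A [[]//]|u v Su Sv A [hA SA]|u a Su A [hA SA]].
  by case: (hA) => _ AD _; apply: AD; [apply: Su | apply: Sv].
by case: (hA) => _ _ AM; apply: AM; apply: Su.
Qed.

(** * Right modules over the group algebra, and the words $w_i$ *)

Section ModuleFacts.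
Variables (K : comNzRingType) (G : groupType).
Implicit Type M : right_module K G.

Lemma rm_actN M (v : M) a : rm_act v (- a) = - rm_act v a.
Proof.
by rewrite -mulrN1 rm_actM -scaleN1r -[-1 : group_algebra K G]scaleN1r rm_actZ.
Qed.

Lemma rm_act0 M (v : M) : rm_act v 0 = 0.
Proof. by apply: (addIr (rm_act v 0)); rewrite -rm_actDr !add0r. Qed.

Lemma rm_act0l M a : rm_act (0 : M) a = 0.
Proof. by apply: (addIr (rm_act 0 a)); rewrite -rm_actDl !add0r. Qed.

Lemma rm_act_signB M (v : M) g (b : bool) :
  rm_act v (gelt K g - (-1) ^+ b) = rm_act v (gelt K g) - (-1) ^+ b *: v.
Proof.
rewrite rm_actDr rm_actN; congr (_ - _).
by case: b; rewrite ?expr1 ?expr0 ?rm_actN rm_act1 ?scaleN1r ?scale1r.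
Qed.

Lemma right_ideal_annihilator M (v : M) :
  right_ideal [set a | rm_act v a = 0].
Proof.
split=> [|a b /= va vb|a b /= va]; first exact: rm_act0.
  by rewrite rm_actDr va vb addr0.
by rewrite rm_actM va rm_act0l.
Qed.

End ModuleFacts.

Definition conj_gen (i : nat) : F2 :=
  (fg_gen (ord_max : 'I_2) ^ fg_gen (ord0 : 'I_2) ^+ i)%g.

(** Because of this, an endomorphism of $F_2$ enters the diagonal argument only as the pair of
    images of the generators, which keeps the count countable. *)
Lemma morph_conj_gen (G : groupType) (h : {multiplicative F2 -> G}) i :
  h (conj_gen i) = (h (fg_gen ord_max) ^ h (fg_gen ord0) ^+ i)%g.
Proof.
have h1 : h 1%g = 1%g by apply: (mulgI (h 1%g)); rewrite -gmulfM !mulg1.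
have hX n x : h (x ^+ n)%g = (h x ^+ n)%g.
  by elim: n => [|n IHn]; rewrite ?expg0 // !expgS gmulfM IHn.
rewrite /conj_gen /conjg !gmulfM hX; congr (_ * _)%g.
by apply: (mulIg (h (fg_gen ord0 ^+ i)%g)); rewrite -gmulfM mulVg h1 hX mulVg.
Qed.

(** * A module realising finitely many prescribed signs *)

Section SignedPermutations.
Variables (K : comNzRingType) (eps : nat -> bool) (n : nat).
Local Notation Omega := ('I_n.+1 * bool)%type.
Local Notation V := {ffun Omega -> K^o}.

(** A point $(k,s)$ stands for the signed basis vector $(-1)^s e_k$, so that signed permutations
    become permutations of [Omega]. *)
Let unshift (p : Omega) : Omega := (ord_pred p.1, p.2).
Let flip (p : Omega) : Omega := (p.1, p.2 (+) eps p.1).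

Fact unshift_inj : injective unshift.
Proof.
move=> [k s] [l t] e; have /= -> := congr1 snd e.
by have /= /ord_pred_inj -> := congr1 fst e.
Qed.

Fact flip_inj : injective flip.
Proof.
move=> [k s] [l t] e; have /= ekl := congr1 fst e.
by move: (congr1 snd e); rewrite /= -ekl => /addIb ->.
Qed.

Let to_perm (y : 'I_2) : {perm Omega} :=
  if y == ord0 then perm unshift_inj else perm flip_inj.

Let phi : F2 -> {perm Omega} := fg_lift to_perm.

Let phiM g h : phi (g * h)%g = (phi g * phi h)%g.
Proof. exact: fg_liftM. Qed.

Let phi1 : phi 1%g = 1%g.
Proof. by apply: (mulgI (phi 1%g)); rewrite -phiM !mulg1. Qed.

(** Permutations compose from left to right here, so the inverse is what makes this a right
    action. *)
Definition perm_act (v : V) (g : F2) : V := [ffun p => v ((phi g)^-1%g p)].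

Lemma perm_act_lin g (k : K) (u v : V) :
  perm_act (k *: u + v) g = k *: perm_act u g + perm_act v g.
Proof. by apply/ffunP => p; rewrite !ffunE. Qed.

Lemma perm_act1 v : perm_act v 1%g = v.
Proof. by apply/ffunP => p; rewrite ffunE phi1 invg1 perm1. Qed.

Lemma perm_actM v g h : perm_act v (g * h)%g = perm_act (perm_act v g) h.
Proof. by apply/ffunP => p; rewrite !ffunE phiM invMg permM. Qed.

Definition perm_module : right_module K F2 :=
  module_of_action perm_act_lin perm_act1 perm_actM.

Definition sign_vec : perm_module :=
  [ffun p : Omega => if p.1 == ord0 then (-1) ^+ p.2 else 0].

Lemma sign_vec_neq0 : sign_vec <> 0.
Proof.
by move=> /ffunP/(_ (ord0, false))/eqP; rewrite !ffunE eqxx oner_eq0.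
Qed.

Lemma phi_conj_gen i :
  phi (conj_gen i) = (perm flip_inj ^ (perm unshift_inj ^+ i))%g.
Proof.
by rewrite [phi _]morph_conj_gen; congr (_ ^ _ ^+ _)%g; exact: fg_lift_gen.
Qed.

(** Conjugating by the $i$-th power of the shift makes $w_i$ act over index 0 as [flip] acts over
    index $i$, that is, by the sign $\varepsilon_i$. *)
Lemma sign_vec_conj_gen i : (i <= n)%N ->
  rm_act sign_vec (gelt K (conj_gen i)) = (-1) ^+ eps i *: sign_vec.
Proof.
move=> le_in; rewrite [LHS]ext_act_gelt; apply/ffunP => p; rewrite 3!ffunE.
rewrite phi_conj_gen -conjVg.
set th := (perm unshift_inj ^+ i)%g.
have thE l s : th (l, s) = (iter i (@ord_pred _) l, s).
  rewrite /th permX; elim: i {le_in th} => //= i ->; by rewrite permE.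
have flipV : ((perm flip_inj)^-1)%g = perm flip_inj.
  apply: (mulgI (perm flip_inj)); rewrite mulgV; apply/permP => -[k s].
  by rewrite perm1 permM !permE /flip /= addbK.
(* Writing the point as an image under [th] lets [permJ] evaluate the conjugate. *)
rewrite flipV -[p](permKV th); case: (_ p) => l s.
rewrite permJ permE /flip /= !thE ffunE /=.
case: eqP => [l0|]; last by rewrite scaler0.
suff -> : l = i :> nat by rewrite addbC signr_addb.
(* The index is reached from 0 by $i$ forward steps, with no wrap-around since $i\le n$. *)
have -> : l = iter i (@ordS _) ord0.
  rewrite -l0; elim: (i) l {l0 thE} => // j IHj l.
  by rewrite iterSr iterS ord_predK in IHj *; rewrite -IHj.
elim: i le_in {th thE l0} => // i IHi lt_in.
by rewrite iterS /= (IHi (ltnW lt_in)) modn_small.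
Qed.

End SignedPermutations.

(** * Countability and the diagonal choice of signs *)

Section Countability.

Lemma code_comp (T : Type) (U : countType) (f : T -> U) :
  injective f -> exists c : T -> nat, injective c.
Proof.
move=> f_inj; exists (choice.pickle \o f).
exact: inj_comp (pcan_inj choice.pickleK) f_inj.
Qed.

Variables (K : comNzRingType) (codeK : K -> nat).
Hypothesis codeK_inj : injective codeK.

Lemma group_algebra_code : exists c : group_algebra K F2 -> nat, injective c.
Proof.
pose f (a : group_algebra K F2) :=
  [seq (val g, codeK a@_g) | g <- msupp a].
apply: (@code_comp _ _ f) => a b eab.
have fE c : f c = [seq (val p.1, codeK p.2)
                  | p <- [seq (g, c@_g) | g <- msupp c]].
  by rewrite -map_comp.
have cE (c : group_algebra K F2) : c = \sum_(p <- [seq (g, c@_g)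
    | g <- msupp c]) p.2 *: gelt K p.1.
  by rewrite big_map -gelt_sum.
rewrite (cE a) (cE b); congr bigop.
move: eab; rewrite !fE; apply: inj_map => -[g x] [g' x'] /= [e1 /codeK_inj ->].
by congr (_, _); apply: val_inj.
Qed.

Definition fg_quotient_point :=
  {j : {A : set (group_algebra K F2) | fg_right_ideal A}
     & quotient_module (proj1 (proj2_sig j))}.

(** A finitely generated ideal is recovered from a chosen finite list of generators, and a coset
    from its chosen representative. *)
Lemma fg_quotient_point_code :
  exists c : F2 * F2 * fg_quotient_point -> nat, injective c.
Proof.
have [c c_inj] := group_algebra_code.
pose gens (j : {A : set (group_algebra K F2) | fg_right_ideal A}) :=
  sval (cid (proj2 (proj2_sig j))).
have gens_inj : injective gens.
  move=> j k; rewrite /gens.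
  case: (cid _) => s js; case: (cid _) => t kt /= est.
  apply: eq_sig_hprop => [A p q|]; first exact: Prop_irrelevance.
  by rewrite js est kt.
pose f (d : F2 * F2 * fg_quotient_point) :=
  (val d.1.1, val d.1.2, [seq c a | a <- gens (projT1 d.2)],
   c (repr (projT2 d.2 : rideal_quot (proj1 (proj2_sig (projT1 d.2)))))).
apply: (@code_comp _ _ f).
move=> [[g h] [j q]] [[g' h'] [j' q']] /= [eg eh /(inj_map c_inj)/gens_inj ej].
case: j' / ej q' => q' /c_inj/(can_inj (@reprK _ _)) ->.
by congr (_, _, _); apply: val_inj.
Qed.

End Countability.

Lemma diagonal_signs (K : fieldType) :
  countable [set: K] -> 2%N \notin [pchar K]%R ->
  exists eps : nat -> bool,
    forall (g h : F2) (j : {A : set (group_algebra K F2) | fg_right_ideal A})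
           (q : quotient_module (proj1 (proj2_sig j))),
      (forall i, rm_act q (gelt K (h ^ g ^+ i)%g) = (-1) ^+ eps i *: q) ->
      q = 0.
Proof.
move=> /countable_injP[codeK /in2TT codeK_inj] K_char.
have [c c_inj] := fg_quotient_point_code codeK_inj.
pose P (d : F2 * F2 * fg_quotient_point K) i :=
  rm_act (projT2 d.2) (gelt K (d.1.2 ^ d.1.1 ^+ i)%g) = projT2 d.2.
(* The sign at index [c d] is $-1$ exactly when the word fixes the vector of [d]. Equation number
   [c d] then fails for that vector, unless the vector equals its own negative and so is 0. *)
exists (fun i => `[< exists d, c d = i /\ P d i >]) => g h j q.
set d : F2 * F2 * fg_quotient_point K := (g, h, existT _ j q).
move=> /(_ (c d)); case: asboolP => [[d' [/c_inj -> Pd]]|nP].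
  rewrite [LHS]Pd expr1 scaleN1r /= => /eqP; rewrite -addr_eq0 -mulr2n.
  rewrite -scaler_nat scaler_eq0 => /orP[|/eqP //].
  by move: K_char; rewrite inE /= => /negbTE ->.
by rewrite expr0 scale1r => Pd; case: nP; exists d.
Qed.

(** * Homomorphisms into an ultrapower *)

Section UltrapowerHom.
Variables (I : Type) (F : set_system I) (FU : UltraFilter F).
Variables (K : comNzRingType) (Y : finType).
Variables (M : right_module K (free_group Y)) (v : I -> M).
Let R := Representation M.

(** The linear map sending the basis vector to the class of [v]; it is paired with the diagonal
    embedding of the group. *)
Definition ultra_eval (w : rep_mod (Wrep K unit Y)) :
    rep_mod (ultrapower FU R) :=
  ucls FU (fun i => rm_act (v i) (w tt)).

Fact ultra_eval_linear : linear ultra_eval.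
Proof.
move=> k w w'; rewrite /ultra_eval um_scaleE um_addE; congr ucls.
apply/funext => i; rewrite !ffunE rm_actDr; congr (_ + _).
by rewrite -mulr_algr rm_actM rm_actZ.
Qed.

HB.instance Definition _ :=
  GRing.isLinear.Build K _ _ *:%R ultra_eval ultra_eval_linear.

Definition ultra_diag (g : free_group Y) : rep_grp (ultrapower FU R) :=
  ucls FU (fun=> g).

Fact ultra_diagM : {morph ultra_diag : g h / (g * h)%g}.
Proof. by move=> g h; rewrite /ultra_diag [RHS]ultra_map2E. Qed.

HB.instance Definition _ :=
  monoid.isMultiplicative.Build _ _ ultra_diag ultra_diagM.

Fact ultra_eval_act w g :
  ultra_eval (rep_act w g) = rep_act (ultra_eval w) (ultra_diag g).
Proof.
rewrite ultrapower_actE up_actE; congr ucls; apply/funext => i.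
by rewrite /rep_act ffunE rm_actM.
Qed.

Definition ultrapower_hom : rep_hom (Wrep K unit Y) (ultrapower FU R) :=
  @RepHom K _ _ ultra_eval ultra_diag ultra_eval_act.

End UltrapowerHom.

(** * The ideals of sign equations and the separation *)

Definition sign_ideal (K : comNzRingType) (eps : nat -> bool) (n : nat) :
    set (group_algebra K F2) :=
  smallest (@right_ideal _)
    [set` [seq gelt K (conj_gen i) - (-1) ^+ eps i | i <- iota 0 n]].
Arguments sign_ideal : clear implicits.

Lemma sign_ideal_fg (K : comNzRingType) eps n :
  fg_right_ideal (sign_ideal K eps n).
Proof. by split; [exact: smallest_right_ideal | eexists]. Qed.

Lemma sign_ideal_gen (K : comNzRingType) eps n i : (i < n)%N ->
  sign_ideal K eps n (gelt K (conj_gen i) - (-1) ^+ eps i).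
Proof.
move=> lt_in A [_]; apply; apply/mapP; exists i => //.
by rewrite mem_iota.
Qed.

(** All generators lie in the annihilator of the nonzero vector [sign_vec], a right ideal not
    containing 1. *)
Lemma sign_ideal_proper (K : comNzRingType) eps n : ~ sign_ideal K eps n 1.
Proof.
move=> /(_ [set a | rm_act (sign_vec K eps n) a = 0]) ideal1.
apply: (@sign_vec_neq0 K eps n); rewrite -[LHS]rm_act1; apply: ideal1.
split; first exact: right_ideal_annihilator.
move=> _ /mapP[i + ->]; rewrite mem_iota => /andP[_ /ltnW le_in].
by apply: (etrans (rm_act_signB _ _ _)); rewrite sign_vec_conj_gen // subrr.
Qed.

Lemma quotient_pi_eq0 (K : comNzRingType) (G : groupType)
    (A : set (group_algebra K G)) (hA : right_ideal A) u :
  (\pi_(rideal_quot hA) u)%qT = 0 <-> A u.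
Proof.
have -> : 0 = (\pi_(rideal_quot hA) 0)%qT by rewrite [LHS]piE.
rewrite (rwP eqP) -[_ == _]Quotient.idealrBE subr0.
by split=> [/asboolP|Au]; last exact/asboolP.
Qed.

Lemma hom_mod_signB (K : comNzRingType) (R S : representation K)
    (h : rep_hom R S) x g (b : bool) :
  hom_mod h (rm_act x (gelt K g - (-1) ^+ b)) =
  rep_act (hom_mod h x) (hom_grp h g) - (-1) ^+ b *: hom_mod h x.
Proof. by rewrite rm_act_signB linearB linearZ -hom_act. Qed.

Theorem mainTheorem3 (K : fieldType)
    (K_aleph0 : ([set: K] #= [set: nat])%card)
    (K_char : 2%N \notin [pchar K]%R) :
  let VF2 : representation K := Representation (product_fg_quotients K) in
  exists (I : Type) (F : set_system I) (FU : UltraFilter F),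
    ~ action_type_equivalent (ultrapower FU VF2) VF2.
Proof.
move=> VF2.
have K_count : countable [set: K] by rewrite (eq_countable K_aleph0).
have [eps epsP] := diagonal_signs K_count K_char.
have [F [FU Foo]] := ultraFilterLemma (eventually_filter : ProperFilter \oo).
exists nat, F, FU => equiv.
pose x : rep_mod (Wrep K unit 'I_2) := [ffun=> 1].
pose t i : group_algebra K F2 := gelt K (conj_gen i) - (-1) ^+ eps i.
pose T : set (rep_mod (Wrep K unit 'I_2)) := range (fun i => rm_act x (t i)).
have xV : nabla2 VF2 T x.
  move=> h Th; apply: functional_extensionality_dep => j.
  (* The image of [x] is tested one coordinate at a time, since the diagonal choice handles vectors
     of a single quotient. *)
  apply: (epsP (hom_grp h (fg_gen ord0)) (hom_grp h (fg_gen ord_max))) => i.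
  have : hom_mod h (rm_act x (t i)) = 0 by apply: Th; exists i.
  rewrite hom_mod_signB morph_conj_gen => /eqP; rewrite subr_eq0 => /eqP.
  exact: (congr1 (fun v : dprod _ => v j)).
suff : ~ nabla2 (ultrapower FU VF2) T x by rewrite equiv.
pose v (n : nat) : product_fg_quotients K := fun j =>
  if `[< forall i, (i < n)%N -> proj1_sig j (t i) >] then
    (\pi_(rideal_quot (proj1 (proj2_sig j))) 1)%qT else 0.
move=> /(_ (ultrapower_hom FU v)) kerx.
have /kerx : nabla T (ultrapower_hom FU v).
  (* The ultrafilter contains all cofinite sets, and [v n] is killed by [t i] as soon as $n>i$. *)
  move=> _ [i _ <-]; apply/uclsP; apply: Foo; exists i.+1 => // n /= lt_in.
  apply: functional_extensionality_dep => j; rewrite /= ffunE ffunE mul1r.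
  rewrite /dp_act /v; case: asboolP => [tj|_].
    by rewrite [LHS]iq_actE mul1r; apply/quotient_pi_eq0; exact: tj.
  exact: (@rm_act0l _ _ (quotient_module _)).
move/uclsP => F0; have [n /= vn0] := filter_ex F0.
apply: (@sign_ideal_proper K eps n).
have {vn0} : v n = 0 by rewrite -[LHS](rm_act1 (v n)) -[RHS]vn0 ffunE.
(* At the coordinate of [sign_ideal K eps n], the vector [v n] is the coset of 1; its vanishing
   would put 1 in that ideal. *)
move/(congr1 (fun w : dprod _ => w (exist _ _ (sign_ideal_fg K eps n)))).
rewrite /v /=; case: asboolP => [_ /quotient_pi_eq0 //|[]].
exact: sign_ideal_gen.
Qed.
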